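(* Let $k\ge 3$ be odd and let $G$ be an odd unicycle graph of girth $k$, whose unique cycle has vertices $u_0\sim u_1\sim\dots\sim u_{k-1}\sim u_0$. If the Grover walk on $G$ is periodic, then one of the following holds: (i) $\deg u_0=\deg u_1=\dots=\deg u_{k-1}=2$; (ii) there exists $0\le i\le k-1$ with $\deg u_i=4$ and $\deg u_l=2$ for all $l\neq i$.
   Context: Graphs are simple, connected and finite. An odd unicycle graph is a non-bipartite graph $G$ with $|V(G)|=|E(G)|$, i.e. a connected graph containing exactly one cycle, which has odd length; that length is its girth. For $G=(V,E)$, let $\mathcal{A}=\{(u,v),(v,u)\mid uv\in E\}$; for an arc $e=(u,v)$ write $o(e)=u$, $t(e)=v$, $\bar e=(v,u)$. The Grover walk has time evolution $U$ on $\mathbb{C}^{\mathcal{A}}$ with $U_{e,f}=2/\deg t(f)$ if $t(f)=o(e)$, $e\neq\bar f$; $U_{e,f}=2/\deg t(f)-1$ if $e=\bar f$; $0$ otherwise. The walk is periodic if $U^m=I$ for some positive integer $m$. *)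

(* Defs.v *)
From HB Require Import structures.
From mathcomp Require Import all_boot all_order all_algebra.
Set Implicit Arguments. Unset Strict Implicit. Unset Printing Implicit Defensive.
Import Order.TTheory GRing.Theory Num.Theory.
Local Open Scope ring_scope.

Definition simple_graph (V : finType) (e : rel V) : Prop :=
  symmetric e /\ irreflexive e.

Definition connected_graph (V : finType) (e : rel V) : Prop :=
  forall x y : V, connect e x y.

Definition bipartite (V : finType) (e : rel V) : Prop :=
  exists c : V -> bool, forall x y, e x y -> c x != c y.

Definition deg (V : finType) (e : rel V) (x : V) : nat := #|[set y | e x y]|.

Definition arc (V : finType) (e : rel V) := {a : V * V | e a.1 a.2}.

Definition arc_o (V : finType) (e : rel V) (a : arc e) : V := (val a).1.
Definition arc_t (V : finType) (e : rel V) (a : arc e) : V := (val a).2.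

Definition n_edges (V : finType) (e : rel V) : nat := (#|{: arc e}| %/ 2)%N.

Definition odd_unicycle (V : finType) (e : rel V) : Prop :=
  [/\ simple_graph e, connected_graph e, ~ bipartite e & #|V| = n_edges e].

Definition grover_entry (V : finType) (e : rel V) (a f : arc e) : rat :=
  if arc_t f == arc_o a then
    if (val a == ((val f).2, (val f).1)) then 2 / (deg e (arc_t f))%:R - 1
    else 2 / (deg e (arc_t f))%:R
  else 0.

Definition grover (V : finType) (e : rel V) : 'M[rat]_#|{: arc e}| :=
  \matrix_(i, j) grover_entry (enum_val i) (enum_val j).

Definition grover_periodic (V : finType) (e : rel V) : Prop :=
  exists m : nat, (0 < m)%N /\ grover e ^+ m = 1%:M.

(* Main.v *)
(* Let q = 2 * prod_i (2 / deg u_i).  Deleting any edge of the cycle leaves a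
   tree, which is bipartite, so every odd closed walk uses all k edges of the
   cycle; hence tr U^j = 0 for odd j < k, and tr U^k only counts the 2k rooted
   directed traversals of the cycle, so tr U^k = k q.  If U^m = 1, then U is
   diagonalizable with eigenvalues d_i that are roots of unity, and Newton's
   identities show that the coefficient of X^k in prod_i (1 - d_i X) is
   - tr U^k / k = - q.  It is a rational algebraic integer, so prod_i deg u_i
   divides 2^(k+1); as all these degrees are at least 2, they are all 2 except
   possibly one which is 4. *)
From mathcomp Require Import all_boot all_order all_algebra all_field.
From mathcomp Require Import zify.
Require Import Defs.
Set Implicit Arguments. Unset Strict Implicit. Unset Printing Implicit Defensive.
Import Order.TTheory GRing.Theory Num.Theory.
Local Open Scope ring_scope.

(** * Traces of matrices of finite order *)

(** [A] is annihilated by [X^m - 1], which splits with simple roots over [algC], so [A] is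
    diagonalizable; the [d i] are the entries of its diagonal form. *)
Lemma trace_pow_finite_order (n : nat) (A : 'M[algC]_n) (m : nat) :
  (0 < m)%N -> A ^+ m = 1%:M ->
  exists d : 'I_n -> algC, (forall i, d i ^+ m = 1) /\
    forall j, \tr (A ^+ j) = \sum_i d i ^+ j.
Proof.
case: n A => [|n] A m_gt0 Am.
  by exists (fun=> 0); split=> [[]//|j]; rewrite /mxtrace !big_ord0.
have [z prim_z] := C_prim_root_exists m_gt0.
have diagA : diagonalizable A.
  apply/diagonalizableP; exists [seq z ^+ i | i <- index_iota 0 m].
    rewrite map_inj_in_uniq ?iota_uniq // => i j; rewrite !mem_index_iota /=.
    by move=> lt_i lt_j /eqP; rewrite (eq_prim_root_expr prim_z) !modn_small // => /eqP.
  rewrite big_map (factor_Xn_sub_1 prim_z); apply: mxminpoly_min.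
  by rewrite rmorphB rmorphXn /= horner_mx_X rmorph1 Am subrr.
have [P Pu /diagonalizable_forPex[D /(simmxRL Pu) DA]] := diagA.
have powA j : A ^+ j = invmx P *m diag_mx (map_mx (fun x => x ^+ j) D) *m P.
  elim: j => [|j IHj].
    rewrite expr0 (_ : map_mx _ D = const_mx 1) ?diag_const_mx ?mulmx1 ?mulVmx //.
    by apply/rowP=> i; rewrite !mxE expr0.
  have -> : map_mx (fun x => x ^+ j.+1) D
            = \row_i (D 0 i * map_mx (fun x => x ^+ j) D 0 i).
    by apply/rowP=> i; rewrite !mxE exprS.
  by rewrite exprS IHj -mulmx_diag DA -mulmxE !mulmxA mulVmx // mul1mx.
have trA j : \tr (A ^+ j) = \sum_i D 0 i ^+ j.
  rewrite powA mxtrace_mulC mulmxA mulmxV // mul1mx mxtrace_diag.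
  by apply: eq_bigr => i _; rewrite !mxE.
exists (fun i => D 0 i); split=> // i.
have : diag_mx (map_mx (fun x => x ^+ m) D) = 1%:M.
  move: (powA m); rewrite Am => /(congr1 (fun B => P *m B *m invmx P)).
  by rewrite !mulmxA mulmxK // mulmxV // mulmx1 mulmxV // mul1mx.
by move/matrixP/(_ i i); rewrite !mxE eqxx.
Qed.

(* Since [d i ^+ m = 1], the geometric series [X d / (1 - d X)] becomes a
   polynomial after multiplication by [1 - X^m], which turns the logarithmic
   derivative of [P] into an identity between polynomials. *)
Lemma newton_unity_roots (R : comNzRingType) (n m : nat) (d : 'I_n -> R)
    (P : {poly R} := \prod_i (1 - d i *: 'X)) :
  (forall i, d i ^+ m = 1) ->
  forall t, (t <= m)%N ->
  t%:R * P`_t = - \sum_(j < t) P`_j * \sum_i d i ^+ (t - j).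
Proof.
move=> dm t le_tm.
pose S := \poly_(j < m) (\sum_i d i ^+ j.+1).
have geom i : (1 - d i *: 'X) * \sum_(j < m) d i ^+ j.+1 *: 'X^j
              = d i *: (1 - 'X^m) :> {poly R}.
  have := subrXX (1 : {poly R}) (d i *: 'X) m.
  rewrite expr1n exprZn dm scale1r => ->.
  rewrite scalerAr; congr (_ * _); rewrite scaler_sumr; apply: eq_bigr => j _.
  by rewrite expr1n mul1r exprZn scalerA exprS.
(* By the product rule, factor by factor: [geom] replaces [d i *: (1 - X^m)] by the factor times its
   geometric sum. *)
have eqP' : P^`() * (1 - 'X^m) = - (P * S).
  rewrite /P; have -> : S = \sum_i \sum_(j < m) d i ^+ j.+1 *: 'X^j.
    by rewrite /S poly_def exchange_big; apply: eq_bigr => j _; rewrite scaler_suml.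
  elim/big_rec2: _ => [|i s p _ IHp]; first by rewrite derivC mul0r mulr0 oppr0.
  rewrite derivM mulrDl -[X in _ + X]mulrA IHp derivB derivZ derivX derivC.
  have {}geom := geom i; set f := 1 - d i *: 'X in geom *.
  set g := \sum_(j < m) _ in geom *.
  rewrite [(_ - _) * p]mulrC -mulrA (_ : (0 - _) * _ = - (f * g)); last first.
    by rewrite geom sub0r mulNr -scalerAl mul1r.
  by rewrite mulrDr opprD !mulrN mulrA [p * f]mulrC -!mulrA [p * g]mulrC.
case: t le_tm => [|t] le_tm; first by rewrite mul0r big_ord0 oppr0.
(* The degree read off is now [t < m], so the [X^m] term on the left contributes nothing and the
   truncation of [S] is not felt. *)
have := congr1 (fun p : {poly R} => p`_t) eqP'.
rewrite mulrBr mulr1 coefB coefMXn le_tm subr0 coef_deriv coefN coefM.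
rewrite mulr_natl => ->; congr (- _); apply: eq_bigr => j _; congr (_ * _).
have le_jt : (j <= t)%N by rewrite -ltnS.
by rewrite coef_poly subSn // (leq_ltn_trans (leq_subr _ _) le_tm).
Qed.

Lemma trace_finite_order_divisible (n : nat) (A : 'M[rat]_n) (m k : nat) :
  (0 < m)%N -> A ^+ m = 1%:M -> odd k ->
  (forall j, odd j -> (j < k)%N -> \tr (A ^+ j) = 0) ->
  exists z : int, \tr (A ^+ k) = k%:R * z%:~R.
Proof.
move=> m_gt0 Am odd_k trA0.
pose B := map_mx (ratr : rat -> algC) A.
have mapB j : B ^+ j = map_mx ratr (A ^+ j).
  elim: j => [|j IHj]; first by rewrite !expr0 map_mx1.
  by rewrite !exprS IHj -!mulmxE -map_mxM.
have trB j : \tr (B ^+ j) = ratr (\tr (A ^+ j)) by rewrite mapB trace_map_mx.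
(* Newton's identities are available only up to the exponent that kills the matrix; [m * k] replaces
   [m] so that they reach [k]. *)
have Bm : B ^+ (m * k) = 1%:M.
  by rewrite mapB exprM Am -[1%:M]/1 expr1n map_mx1.
have k_gt0 := odd_gt0 odd_k.
have mk_gt0 : (0 < m * k)%N by rewrite muln_gt0 m_gt0.
have [d [dm trd]] := trace_pow_finite_order mk_gt0 Bm.
have := newton_unity_roots dm; set P := \prod_i _ => newton.
have P0 : P`_0 = 1.
  rewrite -horner_coef0 horner_prod big1 // => i _.
  by rewrite !hornerE ?mulr0 ?subr0 ?addr0.
(* For odd [t], exactly one of [j] and [t - j] is odd: each term vanishes through a smaller odd
   coefficient or through an odd trace. *)
have P_odd t : odd t -> (t < k)%N -> P`_t = 0.
  elim/ltn_ind: t => t IHt odd_t lt_tk.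
  have t_neq0 : t%:R != 0 :> algC by rewrite pnatr_eq0 -lt0n odd_gt0.
  apply: (mulfI t_neq0); rewrite mulr0 newton; last first.
    by rewrite (leq_trans (ltnW lt_tk)) // leq_pmull.
  rewrite big1 ?oppr0 // => j _; have lt_jt := ltn_ord j.
  case odd_j: (odd j); first by rewrite IHt ?mul0r // (ltn_trans lt_jt).
  have odd_tj : odd (t - j) by rewrite oddB ?odd_t ?odd_j // ltnW.
  by rewrite -trd trB trA0 ?rmorph0 ?mulr0 // (leq_ltn_trans (leq_subr _ _)).
(* The same parity argument leaves only the term [j = 0]. *)
have Pk : k%:R * P`_k = - ratr (\tr (A ^+ k)).
  rewrite newton ?leq_pmull // (bigD1 (Ordinal k_gt0)) //= P0 mul1r subn0.
  rewrite -trd trB big1 ?addr0 // => j j_neq0; have lt_jk := ltn_ord j.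
  case odd_j: (odd j); first by rewrite P_odd ?mul0r.
  have odd_kj : odd (k - j) by rewrite oddB ?odd_k ?odd_j // ltnW.
  by rewrite -trd trB trA0 ?rmorph0 ?mulr0 // -subn_gt0 subKn ?lt0n // ltnW.
have AintP : P`_k \in Aint.
  have : P \is a polyOver Aint.
    apply: rpred_prod => i _; rewrite rpredB ?rpred1 //.
    rewrite -mul_polyC rpredM ?polyOverX // polyOverC.
    by apply: (Aint_unity_root mk_gt0); apply/unity_rootP.
  by move/polyOverP.
have /intrP[z Dz] : - P`_k \in Num.int.
  rewrite rpredN; apply: Cint_rat_Aint AintP.
  have k_neq0 : k%:R != 0 :> algC by rewrite pnatr_eq0 -lt0n.
  rewrite -[P`_k](mulKf k_neq0) Pk rpredM ?rpredV ?rpred_nat //.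
  by rewrite rpredN; apply/CratP; eexists.
exists z; apply: (fmorph_inj (ratr : {rmorphism rat -> algC})) => /=.
by rewrite rmorphM rmorph_nat rmorph_int -Dz mulrN Pk opprK.
Qed.

(** * Connected graphs with few arcs *)

Section Trees.
Variables (V : finType) (e : rel V).

(* Breadth-first layers: the arcs to and from BFS parents already exhaust
   [2 (#|V| - 1)] arcs, and any other arc would come with its reverse. *)
Lemma few_arcs_bipartite :
  symmetric e -> irreflexive e -> connected_graph e ->
  (#|[set a : V * V | e a.1 a.2]| < 2 * #|V|)%N -> bipartite e.
Proof.
move=> e_sym e_irr e_conn few.
have [r _|V0] := pickP (@predT V); last first.
  by exists (fun=> true) => x; have := V0 x.
have reach x : exists n, [exists p : n.-tuple V, path e r p && (last r p == x)].
  have /connectP[p ep ->] := e_conn r x.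
  by exists (size p); apply/existsP; exists (in_tuple p); rewrite /= ep eqxx.
pose d x := ex_minn (reach x).
have d_le x p : path e r p -> last r p = x -> (d x <= size p)%N.
  move=> ep lpx; rewrite /d; case: ex_minnP => n _; apply.
  by apply/existsP; exists (in_tuple p); rewrite /= ep lpx eqxx.
have d_path x : exists p, [/\ path e r p, last r p = x & size p = d x].
  rewrite /d; case: ex_minnP => n /existsP[p /andP[ep /eqP lp]] _.
  by exists p; rewrite size_tuple.
have parent x : x != r -> exists y, e y x && (d x == (d y).+1).
  move=> x_r; have [p [ep lp sp]] := d_path x.
  case/lastP: p => [|p z] in ep lp sp *; first by rewrite -lp eqxx in x_r.
  rewrite last_rcons in lp; rewrite {z}lp size_rcons rcons_path in ep sp.
  case/andP: ep => ep ex; exists (last r p).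
  rewrite ex /= -sp eqSS eqn_leq d_le // andbT.
  have [q [eq lq sq]] := d_path (last r p).
  by rewrite -ltnS sp -sq -(size_rcons q x) d_le ?last_rcons // rcons_path eq lq.
(* A breadth-first parent; the default value is reached only at the root, which [fP] excludes. *)
pose f x := odflt x [pick y | e y x && (d x == (d y).+1)].
have fP x : x != r -> e (f x) x /\ d x = (d (f x)).+1.
  move=> /parent[y Py]; rewrite /f; case: pickP => [z /andP[ez /eqP dz] //|].
  by move/(_ y); rewrite Py.
pose up := [set (x, f x) | x in [set~ r]].
pose down := [set (f x, x) | x in [set~ r]].
have card_up : #|up| = #|V|.-1.
  by rewrite card_imset ?cardsC1 // => x y [].
have card_down : #|down| = #|V|.-1.
  by rewrite card_imset ?cardsC1 // => x y [].
have dis : [disjoint up & down].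
  apply/pred0P => -[a b] /=; apply/negP => /andP[/imsetP[x]].
  rewrite !inE => /fP[_ dx] [-> ->] /imsetP[y].
  by rewrite !inE => /fP[_ dy] [xy fy]; move: dx dy; rewrite fy -xy; lia.
have V_gt0 : (0 < #|V|)%N by apply/card_gt0P; exists r.
have sub : up :|: down \subset [set a : V * V | e a.1 a.2].
  apply/subsetP => a /setUP[] /imsetP[x]; rewrite !inE => /fP[ex _] -> //=.
  by rewrite e_sym.
have card_tree : #|up :|: down| = (2 * #|V| - 2)%N.
  by rewrite cardsU (disjoint_setI0 dis) cards0 card_up card_down; lia.
(* An arc outside the tree and its reverse would raise the count to [2 * #|V|]. *)
have all_tree x y : e x y -> ((x, y) \in up) || ((x, y) \in down).
  move=> exy; apply/negPn/negP; rewrite negb_or => /andP[nup ndown].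
  have sub2 : [set (x, y); (y, x)] :|: (up :|: down)
              \subset [set a : V * V | e a.1 a.2].
    rewrite subUset sub andbT; apply/subsetP => a; rewrite !inE.
    by case/orP => /eqP-> //=; rewrite e_sym.
  have xy : (x, y) != (y, x).
    by apply/eqP => -[yx _]; move: exy; rewrite yx e_irr.
  have nyx : (y, x) \notin up :|: down.
    rewrite inE negb_or; apply/andP; split.
      by apply: contra ndown => /imsetP[z Pz [-> ->]]; apply/imsetP; exists z.
    by apply: contra nup => /imsetP[z Pz [-> ->]]; apply/imsetP; exists z.
  have dis2 : [set (x, y); (y, x)] :&: (up :|: down) = set0.
    apply/setP => a; rewrite !inE; apply/negP => /andP[/orP[]/eqP->].
      by rewrite (negPf nup) (negPf ndown).
    by rewrite inE in nyx; rewrite (negPf nyx).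
  have := subset_leq_card sub2.
  by rewrite cardsU dis2 cards0 cards2 xy card_tree; lia.
(* All arcs join consecutive layers, so the parity of the distance to [r] is a proper colouring. *)
exists (fun x => odd (d x)) => x y /all_tree /orP[] /imsetP[z].
  by rewrite !inE => /fP[_ dz] [-> ->]; rewrite dz /=; case: odd.
by rewrite !inE => /fP[_ dz] [-> ->]; rewrite dz /=; case: odd.
Qed.

End Trees.

(** * Matrix powers as sums over weighted walks *)

Fixpoint walk_sum (R : pzSemiRingType) (T : finType) (W : T -> T -> R)
    (j : nat) (a b : T) : R :=
  if j is j'.+1 then \sum_c W a c * walk_sum W j' c b else (a == b)%:R.

Section WalkSum.
Variables (R : pzSemiRingType) (T : finType) (W : T -> T -> R).

Lemma mulmx_walk_sum (j : nat) (i i' : 'I_#|T|) :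
  ((\matrix_(i, i') W (enum_val i) (enum_val i') : 'M[R]_#|T|) ^+ j) i i'
  = walk_sum W j (enum_val i) (enum_val i').
Proof.
elim: j i => [|j IHj] i; first by rewrite expr0 mxE /= (inj_eq enum_val_inj).
rewrite exprS -mulmxE mxE /= [RHS](reindex_onto enum_val enum_rank) /=; last first.
  by move=> c _; rewrite enum_rankK.
apply: eq_big => [l|l _]; first by rewrite enum_valK eqxx.
by rewrite mxE IHj.
Qed.

Lemma trace_walk_sum (j : nat) :
  \tr ((\matrix_(i, i') W (enum_val i) (enum_val i') : 'M[R]_#|T|) ^+ j)
  = \sum_a walk_sum W j a a.
Proof.
rewrite /mxtrace [RHS](reindex_onto enum_val enum_rank) /=; last first.
  by move=> c _; rewrite enum_rankK.
apply: eq_big => [l|l _]; first by rewrite enum_valK eqxx.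
exact: mulmx_walk_sum.
Qed.

Definition support_rel : rel T := fun a b => W a b != 0.

Lemma walk_sum_neq0 (j : nat) (a b : T) : walk_sum W j a b != 0 ->
  exists p, [/\ size p = j, path support_rel a p & last a p = b].
Proof.
elim: j a => [|j IHj] a /=.
  by have [->|] := eqVneq a b; [exists [::] | rewrite eqxx].
move=> sum_neq0; have [c Wac] : exists c, W a c * walk_sum W j c b != 0.
  apply/existsP; apply: contraNT sum_neq0 => /existsPn all0.
  by rewrite big1 // => c _; apply/eqP/negPn/all0.
have /IHj[p [sp pp lp]] : walk_sum W j c b != 0.
  by apply: contraNneq Wac => ->; rewrite mulr0.
exists (c :: p); split; rewrite /= ?sp ?pp ?andbT //.
by apply: contraNneq Wac => ->; rewrite mul0r.
Qed.

(** Expand along the first step: a nonzero term for another first vertex would yield a second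
    supported walk. The walk [q] itself may have weight zero, in which case both sides vanish. *)
Lemma walk_sum_unique (a : T) (q : seq T) :
  (forall p, size p = size q -> path support_rel a p -> last a p = last a q ->
     p = q) ->
  walk_sum W (size q) a (last a q) = \prod_(s <- zip (a :: q) q) W s.1 s.2.
Proof.
elim: q a => [|c q IHq] a uniq_q /=; first by rewrite eqxx big_nil.
rewrite big_cons /= (bigD1 c) //= [X in _ + X]big1 => [|c' c'c].
  rewrite addr0; have [->|Wac] := eqVneq (W a c) 0; first by rewrite !mul0r.
  congr (_ * _); apply: IHq => p sp pp lp.
  by have [] : c :: p = c :: q by apply: uniq_q; rewrite //= ?sp //; apply/andP.
apply/eqP; apply: contraT => neq0.
have /walk_sum_neq0[p [sp pp lp]] : walk_sum W (size q) c' (last c q) != 0.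
  by apply: contraNneq neq0 => ->; rewrite mulr0.
have Wac' : W a c' != 0 by apply: contraNneq neq0 => ->; rewrite mul0r.
have [] : c' :: p = c :: q by apply: uniq_q; rewrite //= ?sp //; apply/andP.
by move/eqP: c'c.
Qed.

End WalkSum.

(** * Odd closed walks *)

(** The cycle is unrolled to a periodic sequence on all of [nat], so that shifting the starting
    point or reversing the direction needs no wrap-around. *)
Definition cycle_param (V : finType) (e : rel V) (k : nat) (v : nat -> V) :=
  [/\ forall i, v (i + k)%N = v i,
      forall i j, v i = v j -> i = j %[mod k]
    & forall i, e (v i) (v i.+1)].

Lemma cycle_param_modn (V : finType) (e : rel V) (k : nat) (v : nat -> V) i :
  cycle_param e k v -> v (i %% k)%N = v i.
Proof.
case=> v_per _ _; rewrite {2}(divn_eq i k); elim: (i %/ k)%N => [|q IHq] //.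
by rewrite mulSn -addnA addnC v_per.
Qed.

(* [k - 1] is [-1] modulo [k]. *)
Lemma cycle_param_rev (V : finType) (e : rel V) (k : nat) (v : nat -> V) :
  (0 < k)%N -> symmetric e ->
  cycle_param e k v -> cycle_param e k (fun i => v (i * k.-1)%N).
Proof.
move=> k_gt0 e_sym [v_per v_inj v_adj].
have v_perM i j : v (i + j * k)%N = v i.
  by elim: j => [|j IHj]; rewrite ?addn0 // mulSn addnCA addnC v_per.
split=> [i|i j /v_inj/eqP eq_ij|i].
- by rewrite mulnDl [(k * _)%N]mulnC v_perM.
- apply/eqP; move: eq_ij; rewrite -(eqn_modDr (i + j)) => /eqP eq_ij.
  have E a b : (a * k.-1 + (a + b) = a * k + b)%N by nia.
  by move: eq_ij; rewrite E [(i + j)%N]addnC E !modnMDl => ->.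
- rewrite e_sym; have := v_adj (i.+1 * k.-1)%N.
  by rewrite (_ : (i.+1 * k.-1).+1 = i * k.-1 + k)%N ?v_per //; nia.
Qed.

Section Cycle.
Variables (V : finType) (e : rel V) (k : nat) (v : nat -> V).
Hypotheses (e_sym : symmetric e) (e_irr : irreflexive e).
Hypotheses (k_ge3 : (3 <= k)%N) (v_cycle : cycle_param e k v).

Let v_per i : v (i + k)%N = v i. Proof. by case: v_cycle. Qed.
Let v_inj i j : v i = v j -> i = j %[mod k].
Proof. by case: v_cycle => _ + _; apply. Qed.
Let v_adj i : e (v i) (v i.+1). Proof. by case: v_cycle. Qed.

Let v_mod i : v (i %% k)%N = v i. Proof. exact: cycle_param_modn v_cycle. Qed.

Let v_eq i j : i = j %[mod k] -> v i = v j.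
Proof. by rewrite -[v i]v_mod -[v j]v_mod => ->. Qed.

Let v_neqD i d : (0 < d < k)%N -> v i <> v (i + d)%N.
Proof.
move=> /andP[d_gt0 d_lt] /v_inj/eqP; rewrite -{1}[i]addn0 eqn_modDl mod0n.
by rewrite modn_small // => /eqP d0; rewrite -d0 in d_gt0.
Qed.

Definition on_cycle_edge i (a : arc e) : bool :=
  (val a == (v i, v i.+1)) || (val a == (v i.+1, v i)).

(** This is the zero pattern of the entry of [U] at [(a, c)]: a path for [meets] therefore follows
    the arcs backwards. *)
Definition meets : rel (arc e) := fun a c => arc_t c == arc_o a.

Lemma on_cycle_edge_inj i j a :
  on_cycle_edge i a -> on_cycle_edge j a -> i = j %[mod k].
Proof.
(* Two edges matched with opposite orientations would give [v m = v (m + 2)], impossible as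
   [2 < k]. *)
have shift2 l m : v l = v m.+1 -> v l.+1 = v m -> False.
  move=> /v_inj lm /v_inj lm1; apply: (@v_neqD m 2); first lia.
  apply: v_eq; rewrite -lm1 addn2 -[l.+1]addn1 -[m.+2]addn1.
  by rewrite -modnDml lm modnDml.
rewrite /on_cycle_edge; case/orP=> /eqP-> /orP[]/eqP[].
- by move=> /v_inj.
- by move=> h1 h2; case: (shift2 _ _ h1 h2).
- by move=> h1 h2; case: (shift2 _ _ h2 h1).
- by move=> _ /v_inj.
Qed.

Definition del_edge i : rel V := fun x y =>
  [&& e x y, (x, y) != (v i, v i.+1) & (x, y) != (v i.+1, v i)].

Lemma del_edge_sym i : symmetric (del_edge i).
Proof.
move=> x y; rewrite /del_edge e_sym !xpair_eqE; congr (_ && _).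
by do !case: (_ == _).
Qed.

(** A use of the deleted edge is replaced by the detour of [k - 1] steps around the rest of the
    cycle. *)
Lemma connected_del_edge i : connected_graph e -> connected_graph (del_edge i).
Proof.
set e' := del_edge i => e_conn.
have arc_path j : (j < k)%N -> connect e' (v i.+1) (v (i.+1 + j)%N).
  elim: j => [|j IHj] lt_jk; first by rewrite addn0.
  apply: connect_trans (IHj (ltnW lt_jk)) _; apply: connect1.
  rewrite /e' /del_edge addnS v_adj /=; apply/andP; split; apply/eqP => -[].
    by move=> h _; apply: (@v_neqD i j.+1); [lia | rewrite -h; congr v; lia].
  move=> h1 h2; case: j => [|j] in lt_jk h1 h2 {IHj} *.
    by apply: (@v_neqD i 2); [lia | rewrite -h2; congr v; lia].
  by apply: (@v_neqD i.+1 j.+1); [lia | rewrite -h1; congr v; lia].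
have long_way : connect e' (v i.+1) (v i).
  by rewrite -(v_per i) (_ : i + k = i.+1 + k.-1)%N ?arc_path //; lia.
move=> x y; apply: connect_sub (e_conn x y) => {}x {}y exy.
have [/eqP[-> ->]|nf] := boolP ((x, y) == (v i, v i.+1)).
  by rewrite (sym_connect_sym (del_edge_sym i)).
have [/eqP[-> ->] //|nb] := boolP ((x, y) == (v i.+1, v i)).
by apply: connect1; rewrite /e' /del_edge exy nf nb.
Qed.

(** Deletion removes two arcs, which brings the count below [2 * #|V|]. *)
Lemma bipartite_del_edge i :
  connected_graph e -> (#|[set a : V * V | e a.1 a.2]| <= (2 * #|V|).+1)%N ->
  bipartite (del_edge i).
Proof.
move=> e_conn few; apply: few_arcs_bipartite.
- exact: del_edge_sym.
- by move=> x; rewrite /del_edge e_irr.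
- exact: connected_del_edge.
set E' := [set a | _].
have dis : [set (v i, v i.+1); (v i.+1, v i)] :&: E' = set0.
  apply/setP=> -[x y]; rewrite !inE /del_edge /=; apply/negP.
  by case/and4P => /orP[]/eqP[-> ->] _; rewrite eqxx.
have neq : (v i, v i.+1) != (v i.+1, v i).
  by apply/eqP => -[h _]; have := v_adj i; rewrite -h e_irr.
have sub : [set (v i, v i.+1); (v i.+1, v i)] :|: E'
           \subset [set a : V * V | e a.1 a.2].
  apply/subsetP=> a; rewrite !inE /del_edge => /orP[/orP[]/eqP->|/and3P[//]] /=.
    exact: v_adj.
  by rewrite e_sym v_adj.
have := subset_leq_card sub.
by rewrite cardsU dis cards0 cards2 neq; move: few; lia.
Qed.

Hypotheses (e_conn : connected_graph e)
  (few : (#|[set a : V * V | e a.1 a.2]| <= (2 * #|V|).+1)%N).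

(** A walk avoiding the edge lives in a bipartite graph, where each step flips the colour, so it
    cannot close up after an odd number of steps. *)
Lemma odd_closed_walk_uses_edge i a p :
  path meets a p -> last a p = a -> odd (size p) -> has (on_cycle_edge i) p.
Proof.
move=> ap lp odd_p; apply/negPn/negP => /hasPn avoid.
have [c cP] := bipartite_del_edge i e_conn few.
have col : c (arc_o (last a p)) = c (arc_o a) (+) odd (size p).
  elim: p a ap avoid {lp odd_p} => [|b p IHp] a /=; first by rewrite addbF.
  case/andP=> /eqP ab bp avoid; rewrite IHp //; last first.
    by move=> x xp; apply: avoid; rewrite inE xp orbT.
  have : c (val b).1 != c (val b).2.
    apply: cP; rewrite /del_edge (valP b) /= -surjective_pairing -negb_or.
    by apply: avoid; rewrite mem_head.
  rewrite -/(arc_o b) -/(arc_t b) ab.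
  by case: (c _); case: (c _); case: odd.
by move: col; rewrite lp odd_p; case: (c _).
Qed.

(** Pick in [p] one arc on each of the [k] cycle edges; these arcs are distinct since no arc lies on
    two cycle edges. If [p] has no room for more, it consists of these arcs. *)
Lemma odd_closed_walk_structure a p :
  path meets a p -> last a p = a -> odd (size p) ->
  (k <= size p)%N /\
  ((size p <= k)%N ->
    {in p, forall x, exists i, on_cycle_edge i x} /\
    forall i, {in p &, forall x y,
      on_cycle_edge i x -> on_cycle_edge i y -> x = y}).
Proof.
move=> ap lp odd_p.
have has_edge i := odd_closed_walk_uses_edge i ap lp odd_p.
pose g i := nth a p (find (on_cycle_edge i) p).
have g_edge i : on_cycle_edge i (g i) by apply: nth_find.
have g_p i : g i \in p by rewrite mem_nth // -has_find.
pose s := [seq g i | i <- iota 0 k].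
have uniq_s : uniq s.
  rewrite map_inj_in_uniq ?iota_uniq // => i j; rewrite !mem_iota => lt_i lt_j gij.
  have := on_cycle_edge_inj (g_edge i); rewrite gij => /(_ j (g_edge j)).
  by rewrite !modn_small.
have sub_s : {subset s <= p} by move=> x /mapP[i _ ->].
have size_s : size s = k by rewrite size_map size_iota.
split; first by rewrite -size_s uniq_leq_size.
move=> le_pk; rewrite -size_s in le_pk.
have [_ mem_s] := uniq_min_size uniq_s sub_s le_pk.
split=> [x|i x y]; first by rewrite -mem_s => /mapP[i _ ->]; exists i.
rewrite -!mem_s => /mapP[j j_k ->] /mapP[l l_k ->].
move=> /(on_cycle_edge_inj (g_edge j)) ji /(on_cycle_edge_inj (g_edge l)) li.
by move: j_k l_k ji; rewrite !mem_iota -li => j_k l_k; rewrite !modn_small // => ->.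
Qed.

Definition bwd_arc i : arc e := exist _ (v i.+1, v i) (etrans (e_sym _ _) (v_adj i)).

(** Every arc lies on a cycle edge and no edge is used twice, so the walk can neither leave the
    cycle nor turn back. Since [meets] reads arcs backwards, the indices of the [bwd_arc]
    increase. *)
Lemma closed_walk_bwd_arc i p :
  odd k -> size p = k -> path meets (bwd_arc i) p ->
  last (bwd_arc i) p = bwd_arc i -> p = map bwd_arc (iota i.+1 k).
Proof.
move=> odd_k size_p ip lp.
have odd_p : odd (size p) by rewrite size_p.
have [_ /(_ (eq_leq size_p))[all_edge edge_once]] :=
  odd_closed_walk_structure ip lp odd_p.
have start_p : bwd_arc i \in p.
  by rewrite -{1}lp; case: (p) odd_p => //= x q _; apply: mem_last.
(* Induction needs arbitrary pieces [q] of the walk, while the constraints on edges stay those of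
   the full walk [p]. *)
suff walk q j : bwd_arc j \in p -> path meets (bwd_arc j) q -> {subset q <= p} ->
    q = map bwd_arc (iota j.+1 (size q)).
  by rewrite -[in iota _ k]size_p; apply: walk.
elim: q j => //= b q IHq {ip lp start_p}i start_p /andP[ib bq] sub.
have b_p : b \in p by apply: sub; rewrite mem_head.
have Db : b = bwd_arc i.+1.
  move: ib; rewrite /meets /arc_t /arc_o /= => /eqP b2.
  have [l l_b] := all_edge _ b_p; move: (l_b) => /orP[]/eqP vb.
    (* Here [b] would be the reverse of [bwd_arc i], a second arc of [p] on edge [i]. *)
    have li : l.+1 = i.+1 %[mod k] by apply: v_inj; rewrite -b2 vb.
    have {}li : v l = v i.
      by apply: v_eq; apply/eqP; rewrite -(eqn_modDr 1) !addn1; apply/eqP.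
    have i_b : on_cycle_edge i b by apply/orP; left; rewrite vb li -b2 vb /= eqxx.
    have i_i : on_cycle_edge i (bwd_arc i) by rewrite /on_cycle_edge eqxx orbT.
    have := edge_once i _ _ b_p start_p i_b i_i => /(congr1 val).
    by rewrite vb /= => -[h _]; have := v_adj i; rewrite -h li e_irr.
  apply: val_inj; rewrite vb /=; move: b2; rewrite vb /= => li.
  rewrite li; congr (_, _); apply: v_eq.
  by rewrite -[l.+1]addn1 -[i.+2]addn1 -modnDml (v_inj li) modnDml.
rewrite -Db; congr (_ :: _); rewrite Db in b_p bq; apply: IHq => // x xq.
by apply: sub; rewrite inE xq orbT.
Qed.

End Cycle.

(** * Traces of the Grover walk *)

(** The indices in [h] form a complete residue system modulo [k]; this covers both shifted and
    reversed traversals. *)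
Lemma big_cycle_param (V : finType) (e : rel V) (k : nat) (v : nat -> V)
    (R : comPzSemiRingType) (F : V -> R) (h : seq nat) :
  (0 < k)%N -> cycle_param e k v -> size h = k ->
  {in h &, forall i j, i = j %[mod k] -> i = j} -> uniq h ->
  \prod_(i <- h) F (v i) = \prod_(i < k) F (v i).
Proof.
move=> k_gt0 v_cycle size_h h_inj uniq_h; have [_ v_inj _] := v_cycle.
rewrite -(big_mkord xpredT (fun i => F (v i))) -!(big_map v xpredT F).
apply: perm_big; have uniq_vh : uniq (map v h).
  by rewrite map_inj_in_uniq // => i j ih jh /v_inj; apply: h_inj.
have sub_vh : {subset map v h <= map v (index_iota 0 k)}.
  move=> x /mapP[i _ ->]; rewrite -(cycle_param_modn i v_cycle).
  by rewrite map_f // mem_index_iota ltn_pmod.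
have size_vh : (size (map v (index_iota 0 k)) <= size (map v h))%N.
  by rewrite !size_map size_iota size_h subn0.
have [eq_size eq_mem] := uniq_min_size uniq_vh sub_vh size_vh.
by apply: uniq_perm => //; rewrite -(eq_uniq eq_size eq_mem).
Qed.

Section CycleWeight.
Variables (V : finType) (e : rel V) (k : nat) (v : nat -> V).
Hypotheses (e_sym : symmetric e) (e_irr : irreflexive e).
Hypotheses (k_ge3 : (3 <= k)%N) (odd_k : odd k) (v_cycle : cycle_param e k v).
Hypotheses (e_conn : connected_graph e)
  (few : (#|[set a : V * V | e a.1 a.2]| <= (2 * #|V|).+1)%N).

Let weight : rat := \prod_(i < k) (2 / (deg e (v i))%:R).

Lemma grover_support_meets (a : arc e) p :
  path (support_rel (@grover_entry V e)) a p -> path (@meets V e) a p.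
Proof.
apply: sub_path => {p}a c; rewrite /support_rel /grover_entry /meets.
by case: (arc_t c == arc_o a); rewrite ?eqxx.
Qed.

Lemma walk_sum_bwd_arc i :
  walk_sum (@grover_entry V e) k (bwd_arc e_sym v_cycle i) (bwd_arc e_sym v_cycle i)
  = weight.
Proof.
have [v_per v_inj v_adj] := v_cycle.
pose b := bwd_arc e_sym v_cycle; rewrite -/b.
have b_per j : b (j + k)%N = b j.
  by apply: val_inj; rewrite /= -addSn !v_per.
have last_b : last (b i) (map b (iota i.+1 k)) = b i.
  rewrite -{2}(b_per i) last_map; congr b.
  by rewrite -nth_last size_iota nth_iota; lia.
have := @walk_sum_unique _ _ (@grover_entry V e) (b i) (map b (iota i.+1 k)).
rewrite last_b size_map size_iota => ->; last first.
  move=> p size_p /grover_support_meets ip lp.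
  exact: (closed_walk_bwd_arc e_irr k_ge3 e_conn few odd_k).
have -> : \prod_(s <- zip (b i :: map b (iota i.+1 k)) (map b (iota i.+1 k)))
             grover_entry s.1 s.2
          = \prod_(j <- iota i.+1 k) (2 / (deg e (v j))%:R).
  elim: (k) i {last_b} => [|n IHn] i /=; first by rewrite !big_nil.
  rewrite !big_cons /= -IHn; congr (_ * _).
  rewrite /grover_entry /arc_t /arc_o /= eqxx xpair_eqE eqxx /=.
  (* The entry for a reversed arc, [2 / deg - 1], would require [v i = v (i + 2)], excluded by
     [k >= 3]. *)
  case: eqP => // h.
  have /eqP := v_inj _ _ h; rewrite -{1}[i]addn0 -addn2 eqn_modDl mod0n modn_small //.
apply: (@big_cycle_param V e k v _ (fun x => 2 / (deg e x)%:R) _ _ v_cycle);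
  rewrite ?size_iota ?iota_uniq //; first lia.
move=> j l; rewrite !mem_iota => j_in l_in.
wlog le_jl : j l j_in l_in / (j <= l)%N.
  by move=> W; case/orP: (leq_total j l) => [/W|/W h /esym/h ->]; auto.
move=> /esym/eqP; rewrite eqn_mod_dvd // => /dvdnP[q Dq].
by case: q Dq => [|q] Dq; nia.
Qed.

End CycleWeight.

Section GroverTrace.
Variables (V : finType) (e : rel V) (k : nat) (v : nat -> V).
Hypotheses (e_sym : symmetric e) (e_irr : irreflexive e).
Hypotheses (k_ge3 : (3 <= k)%N) (odd_k : odd k) (v_cycle : cycle_param e k v).
Hypotheses (e_conn : connected_graph e)
  (few : (#|[set a : V * V | e a.1 a.2]| <= (2 * #|V|).+1)%N).

(** A forward arc of the cycle is a backward arc of the reversed parametrization, so one orientation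
    suffices. *)
Lemma walk_sum_edge_arc i (a : arc e) : on_cycle_edge v i a ->
  walk_sum (@grover_entry V e) k a a = \prod_(j < k) (2 / (deg e (v j))%:R).
Proof.
have k_gt0 : (0 < k)%N by lia.
have [v_per v_inj v_adj] := v_cycle.
case/orP=> /eqP va; last first.
  rewrite -(walk_sum_bwd_arc e_sym e_irr k_ge3 odd_k v_cycle e_conn few i).
  by congr walk_sum; apply: val_inj.
have w_cycle := cycle_param_rev k_gt0 e_sym v_cycle.
have v_perM l q : v (l + q * k)%N = v l.
  by elim: q => [|q IHq]; rewrite ?addn0 // mulSn addnCA addnC v_per.
(* The reversed cycle takes [v (- j)] at [j], so the index is [- (i + 1)] modulo [k]. *)
have -> : a = bwd_arc e_sym w_cycle (i.+1 * k.-1)%N.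
  apply: val_inj; rewrite va /=; congr (_, _).
    rewrite (_ : _ * _ = i + (i * (k - 2) + (k - 1)) * k)%N ?v_perM //.
    by case: k k_ge3 => [|[|k']] //= _; nia.
  rewrite (_ : _ * _ * _ = i.+1 + i.+1 * (k - 2) * k)%N ?v_perM //.
  by case: k k_ge3 => [|[|k']] //= _; nia.
rewrite (walk_sum_bwd_arc e_sym e_irr k_ge3 odd_k w_cycle e_conn few).
rewrite -(@big_cycle_param _ e k v _ (fun x => 2 / (deg e x)%:R)
            [seq i * k.-1 | i <- iota 0 k]%N) ?size_map ?size_iota //.
- by rewrite big_map -(subn0 k) -/(index_iota 0 _) big_mkord subn0.
- move=> _ _ /mapP[x xk ->] /mapP[y yk ->] h.
  have [_ w_inj _] := w_cycle; have := w_inj x y.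
  rewrite -[v _](cycle_param_modn _ v_cycle) h (cycle_param_modn _ v_cycle).
  move=> /(_ erefl); rewrite !mem_iota in xk yk.
  by rewrite !modn_small // => ->.
- rewrite map_inj_uniq ?iota_uniq // => x y /eqP.
  by rewrite eqn_pmul2r; [move/eqP|lia].
Qed.

Lemma trace_grover_odd_lt j : odd j -> (j < k)%N -> \tr (grover e ^+ j) = 0.
Proof.
move=> odd_j lt_jk; rewrite trace_walk_sum big1 // => a _.
apply/eqP; apply: contraT => /walk_sum_neq0[p [size_p /grover_support_meets ap lp]].
rewrite -size_p in odd_j lt_jk.
have [] := odd_closed_walk_structure e_sym e_irr k_ge3 v_cycle e_conn few ap lp odd_j.
by rewrite leqNgt lt_jk.
Qed.

Lemma trace_grover_girth :
  \tr (grover e ^+ k) = k%:R * (2 * \prod_(i < k) (2 / (deg e (v i))%:R)).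
Proof.
have k_gt0 : (0 < k)%N by lia.
have [v_per v_inj v_adj] := v_cycle.
rewrite trace_walk_sum.
rewrite (bigID (fun a : arc e => [exists i : 'I_k, on_cycle_edge v i a])) /=.
(* The start of a closed walk of length [k] is also its last arc, hence lies on a cycle edge: all
   other arcs contribute zero. *)
rewrite [X in _ + X]big1 => [|a]; last first.
  move/existsPn => off; apply/eqP; apply: contraT.
  move=> /walk_sum_neq0[p [size_p /grover_support_meets ap lp]].
  have odd_p : odd (size p) by rewrite size_p.
  have [_ []] :=
    odd_closed_walk_structure e_sym e_irr k_ge3 v_cycle e_conn few ap lp odd_p.
    by rewrite size_p.
  have a_p : a \in p by rewrite -{1}lp; case: (p) odd_p => //= x q _; apply: mem_last.
  move=> /(_ a a_p)[i ia] _; have := off (Ordinal (ltn_pmod i k_gt0)).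
  have v_mod l := cycle_param_modn l v_cycle.
  have v_modS : v (i %% k).+1 = v i.+1 by rewrite -v_mod -addn1 modnDml addn1 v_mod.
  by case/negP; move: ia; rewrite /on_cycle_edge /= v_mod v_modS.
rewrite addr0 (eq_bigr (fun=> \prod_(i < k) (2 / (deg e (v i))%:R))); last first.
  by move=> a /existsP[i]; apply: walk_sum_edge_arc.
rewrite sumr_const.
pose fwd i : arc e := exist _ (v i, v i.+1) (v_adj i).
pose bwd i : arc e := bwd_arc e_sym v_cycle i.
(* The [2k] arcs of the cycle, each contributing the same weight. *)
pose s := map fwd (iota 0 k) ++ map bwd (iota 0 k).
have fwd_edge i : on_cycle_edge v i (fwd i) by rewrite /on_cycle_edge eqxx.
have bwd_edge i : on_cycle_edge v i (bwd i) by rewrite /on_cycle_edge eqxx orbT.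
have edge_inj i j (a : arc e) : (i < k)%N -> (j < k)%N ->
    on_cycle_edge v i a -> on_cycle_edge v j a -> i = j.
  move=> ik jk ia ja; have := on_cycle_edge_inj k_ge3 v_cycle ia ja.
  by rewrite !modn_small.
have uniq_s : uniq s.
  rewrite cat_uniq !map_inj_in_uniq ?iota_uniq /= ?andbT.
  - apply/hasPn => _ /mapP[i ik ->]; apply/negP => /mapP[j jk eq_ij].
    rewrite !mem_iota in ik jk; have := bwd_edge i; rewrite eq_ij => ji.
    have Dij := edge_inj _ _ _ ik jk ji (fwd_edge j).
    move/(congr1 val): eq_ij; rewrite Dij /= => -[h _].
    by have := v_adj j; rewrite h e_irr.
  - move=> i j; rewrite !mem_iota => ik jk h.
    by apply: (edge_inj _ _ (bwd i)) => //; rewrite h.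
  - move=> i j; rewrite !mem_iota => ik jk h.
    by apply: (edge_inj _ _ (fwd i)) => //; rewrite h.
have -> : #|[pred a : arc e | [exists i : 'I_k, on_cycle_edge v i a]]| = (k * 2)%N.
  have <- : #|s| = (k * 2)%N.
    by rewrite (card_uniqP uniq_s) size_cat !size_map size_iota; lia.
  apply: eq_card => a; rewrite inE; apply/existsP/idP.
    case=> i ia; rewrite mem_cat; case/orP: ia => /eqP va; apply/orP.
      by left; apply/mapP; exists (val i); [rewrite mem_iota /= | apply: val_inj].
    by right; apply/mapP; exists (val i); [rewrite mem_iota /= | apply: val_inj].
  rewrite mem_cat => /orP[] /mapP[i]; rewrite mem_iota => ik ->.
    by exists (Ordinal ik).
  by exists (Ordinal ik).
by rewrite -[LHS]mulr_natl natrM mulrA.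
Qed.

End GroverTrace.

(** * Degrees on the cycle *)

(** The successor absorbs the rounding in the division by 2. *)
Lemma n_edges_card_arcs (V : finType) (e : rel V) :
  (#|[set a : V * V | e a.1 a.2]| <= (2 * n_edges e).+1)%N.
Proof.
rewrite /n_edges card_sig cardsE; set n := #|_|.
by lia.
Qed.

Lemma cycle_param_periodic (V : finType) (e : rel V) (k : nat) (u : nat -> V) :
  (0 < k)%N -> {in gtn k &, injective u} ->
  (forall i, (i < k)%N -> e (u i) (u (i.+1 %% k)%N)) ->
  cycle_param e k (fun i => u (i %% k)%N).
Proof.
move=> k_gt0 u_inj u_adj; split=> [i|i j|i]; first by rewrite modnDr.
  by move/u_inj; apply; rewrite inE /= ltn_pmod.
have := u_adj _ (ltn_pmod i k_gt0).
by rewrite -addn1 modnDml addn1.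
Qed.

Lemma cycle_param_deg_ge2 (V : finType) (e : rel V) (k : nat) (v : nat -> V) i :
  symmetric e -> (3 <= k)%N -> cycle_param e k v -> (2 <= deg e (v i))%N.
Proof.
move=> e_sym k_ge3 [v_per v_inj v_adj].
have neq : v i.+1 != v (i + k.-1)%N.
  apply/eqP => /v_inj/eqP; rewrite -addn1 eqn_modDl !modn_small; lia.
have <- : #|[set v i.+1; v (i + k.-1)%N]| = 2%N by rewrite cards2 neq.
apply/subset_leq_card/subsetP => x; rewrite !inE => /orP[]/eqP->; first exact: v_adj.
have := v_adj (i + k.-1)%N; rewrite e_sym.
by rewrite (_ : (i + k.-1).+1 = i + k)%N ?v_per //; lia.
Qed.

(** Each [d i] is a power of 2 with exponent at least 1, and the [k] exponents sum to at most
    [k + 1]: at most one of them exceeds 1, and then by 1. *)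
Lemma prod_dvdn_pow2 (k : nat) (d : 'I_k -> nat) :
  (forall i, 2 <= d i)%N -> (\prod_(i < k) d i %| 2 ^ k.+1)%N ->
  (forall i, d i = 2%N) \/
  (exists i, d i = 4%N /\ forall l, l != i -> d l = 2%N).
Proof.
move=> d_ge2 dvd_d.
have d_pow i : d i = (2 ^ logn 2 (d i))%N.
  have : (d i %| 2 ^ k.+1)%N.
    by apply: dvdn_trans dvd_d; rewrite (bigD1 i) //= dvdn_mulr.
  by case/(dvdn_pfactor _ _ (isT : prime 2)) => m _ ->; rewrite pfactorK.
have log_gt0 i : (0 < logn 2 (d i))%N.
  by rewrite lt0n; apply/eqP => h; have := d_ge2 i; rewrite d_pow h.
have sum_log : (\sum_(i < k) logn 2 (d i) <= k.+1)%N.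
  rewrite -(@dvdn_Pexp2l 2) // expn_sum; apply: dvdn_trans dvd_d.
  by rewrite (eq_bigr _ (fun i _ => d_pow i)).
have [/forallP all1|] := boolP [forall i, logn 2 (d i) == 1%N].
  by left=> i; rewrite d_pow (eqP (all1 i)).
rewrite negb_forall => /existsP[i i_neq1]; right; exists i.
have excess : (\sum_(l < k | l != i) (logn 2 (d l)).-1 + (logn 2 (d i)).-1 <= 1)%N.
  have : (\sum_(l < k) (logn 2 (d l)).-1 + k <= k.+1)%N.
    apply: leq_trans sum_log; rewrite -[X in (_ + X)%N](card_ord k) -sum1_card.
    by rewrite -big_split /=; apply: leq_sum => l _; rewrite addn1 prednK.
  rewrite (bigD1 i) //=; move: (\sum_(_ < k | _) _)%N => s; lia.
have log_i : logn 2 (d i) = 2%N by have := log_gt0 i; move: excess i_neq1; lia.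
split=> [|l l_i]; first by rewrite d_pow log_i.
move: excess; rewrite log_i (bigD1 l) //= => excess.
by rewrite d_pow (_ : logn 2 (d l) = 1%N) //; have := log_gt0 l; lia.
Qed.

Lemma prod_dvdn_of_int (k : nat) (d : 'I_k -> nat) (z : int) :
  (forall i, 0 < d i)%N ->
  2 * \prod_(i < k) (2 / (d i)%:R) = z%:~R :> rat ->
  (\prod_(i < k) d i %| 2 ^ k.+1)%N.
Proof.
move=> d_gt0; rewrite prodf_div prodr_const card_ord -natr_prod mulrA -exprS.
have D_gt0 : (0 < \prod_(i < k) d i)%N by rewrite prodn_gt0.
set D := (\prod_(i < k) d i)%N in D_gt0 *.
have D_neq0 : D%:R != 0 :> rat by rewrite pnatr_eq0 -lt0n.
move/(canRL (divfK D_neq0)) => Dz.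
(* Clearing the denominator [D] turns the rational identity into one between integers. *)
have : (2 ^ k.+1)%N%:Z = z * D%:Z.
  by apply: (@intr_inj rat); rewrite intrM -!pmulrn natrX.
move/(congr1 absz); rewrite abszM !absz_nat => ->; exact: dvdn_mull.
Qed.

Theorem theorem3p2 (V : finType) (e : rel V) (k : nat) (u : nat -> V) :
  odd k -> (3 <= k)%N ->
  odd_unicycle e ->
  {in gtn k &, injective u} ->
  (forall i, (i < k)%N -> e (u i) (u ((i.+1) %% k)%N)) ->
  grover_periodic e ->
  (forall i, (i < k)%N -> deg e (u i) = 2%N) \/
  (exists i, [/\ (i < k)%N, deg e (u i) = 4%N &
                forall l, (l < k)%N -> l != i -> deg e (u l) = 2%N]).
Proof.
move=> odd_k k_ge3 [[e_sym e_irr] e_conn _ V_edges] u_inj u_adj [m [m_gt0 Um]].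
have k_gt0 := odd_gt0 odd_k.
have u_cycle := cycle_param_periodic k_gt0 u_inj u_adj.
have few : (#|[set a : V * V | e a.1 a.2]| <= (2 * #|V|).+1)%N.
  by rewrite V_edges n_edges_card_arcs.
have trU := trace_grover_girth e_sym e_irr k_ge3 odd_k u_cycle e_conn few.
have trU0 := trace_grover_odd_lt e_sym e_irr k_ge3 u_cycle e_conn few.
have [z] := trace_finite_order_divisible m_gt0 Um odd_k trU0.
rewrite trU => /mulfI Dz.
have deg_ge2 (i : 'I_k) : (2 <= deg e (u i))%N.
  have := cycle_param_deg_ge2 i e_sym k_ge3 u_cycle.
  by rewrite modn_small.
have dvd_deg : (\prod_(i < k) deg e (u i) %| 2 ^ k.+1)%N.
  apply: (@prod_dvdn_of_int k (fun i : 'I_k => deg e (u i)) z) => [i|].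
    exact: ltnW (deg_ge2 i).
  rewrite -Dz ?pnatr_eq0 -?lt0n //.
  by congr (_ * _); apply: eq_bigr => i _; rewrite modn_small.
have [all2|[i [deg_i deg_l]]] := prod_dvdn_pow2 deg_ge2 dvd_deg.
  by left=> i ik; apply: (all2 (Ordinal ik)).
right; exists i; split=> // l lk l_i.
exact: (deg_l (Ordinal lk)).
Qed.
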